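(* Let $\mathbb{F}$ be a definite field and let $A$ be a symmetric $n\times n$ matrix over $\mathbb{F}$. If all leading principal minors of $A$ are positive, then $A$ has a Cholesky decomposition.
   Context: An element $x$ of a field $\mathbb{F}$ is called positive if $x=\mu^2$ for some non-zero $\mu\in\mathbb{F}$; then $\mu$ is a square root of $x$, and it is a positive square root if $\mu$ is itself positive. A field is a definite field if each of its positive elements has a positive square root in it. A symmetric $n\times n$ matrix $A$ over a definite field $\mathbb{F}$ has a Cholesky decomposition if $A=LL^T$ for some lower triangular $n\times n$ matrix $L$ over $\mathbb{F}$ all of whose diagonal entries are positive. The leading principal minors of $A$ are the determinants of its upper-left $k\times k$ submatrices, $1\le k\le n$. *)

(* Defs.v *)
From mathcomp Require Import all_boot all_order all_algebra.

Set Implicit Arguments.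
Unset Strict Implicit.
Unset Printing Implicit Defensive.

Import GRing.Theory.
Local Open Scope ring_scope.

(* The field need not be ordered: "positive" means "nonzero square". *)
Definition positive (F : fieldType) (x : F) : Prop :=
  exists2 mu : F, mu != 0 & x = mu ^+ 2.

(* The condition mu != 0 on a square root is implied by [positive mu]. *)
Definition positive_sqrt (F : fieldType) (x mu : F) : Prop :=
  positive mu /\ x = mu ^+ 2.

Definition definite_field (F : fieldType) : Prop :=
  forall x : F, positive x -> exists mu : F, positive_sqrt x mu.

Definition leading_principal_submx (F : fieldType) (n k : nat) (hk : (k <= n)%N)
    (A : 'M[F]_n) : 'M[F]_k :=
  mxsub (widen_ord hk) (widen_ord hk) A.

Definition leading_principal_minor (F : fieldType) (n k : nat) (hk : (k <= n)%N)
    (A : 'M[F]_n) : F :=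
  \det (leading_principal_submx hk A).

(* [is_trig_mx] is lower triangularity: L i j = 0 whenever i < j. *)
Definition has_cholesky (F : fieldType) (n : nat) (A : 'M[F]_n) : Prop :=
  exists L : 'M[F]_n,
    [/\ is_trig_mx L, forall i : 'I_n, positive (L i i) & A = L *m L^T].

(* Main.v *)
Require Import Defs.
From mathcomp Require Import all_boot all_order all_algebra.

Set Implicit Arguments.
Unset Strict Implicit.
Unset Printing Implicit Defensive.

Import GRing.Theory.
Local Open Scope ring_scope.

(** The proof borders a Cholesky factor one row at a time, by induction on the
    size.  Write a symmetric matrix of size [n + 1] as the block matrix of [B],
    [u], [u^T], [d].  The leading principal minors of [B] are among those of the
    whole matrix, so by induction [B = L *m L^T], and [L] is invertible since its
    diagonal entries, being positive, are nonzero; hence there is [v] with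
    [L *m v = u].  Any [mu] with [mu ^+ 2 = d - v^T *m v] makes the lower
    triangular block matrix of [L], [0], [v^T], [mu] a factor of the whole
    matrix.  The Schur complement [d - v^T *m v] is the quotient of the
    determinant of the whole matrix by [\det B = (\det L) ^+ 2] (lemma
    [det_bordered]).  It is thus a quotient of nonzero squares, and a
    definite field supplies a root [mu] that is itself positive. *)

Lemma positive_neq0 (F : fieldType) (x : F) : positive x -> x != 0.
Proof. by case=> mu mu0 ->; rewrite expf_neq0. Qed.

Lemma positive_divX2 (F : fieldType) (x y s : F) :
  positive x -> y != 0 -> x = y ^+ 2 * s -> positive s.
Proof.
case=> mu mu0 -> y0 def_s; exists (mu / y).
  by rewrite mulf_neq0 ?invr_neq0.
by rewrite exprMn def_s exprVn mulrC mulKf ?expf_neq0.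
Qed.

Lemma trig_positive_unitmx (F : fieldType) (n : nat) (L : 'M[F]_n) :
  is_trig_mx L -> (forall i, positive (L i i)) -> L \in unitmx.
Proof.
move=> trigL posL; rewrite unitmxE unitfE det_trig //.
by apply/prodf_neq0 => i _; apply: positive_neq0.
Qed.

Lemma leading_principal_minor_ulsubmx (F : fieldType) (n m k : nat)
    (A : 'M[F]_(n + m)) (hk : (k <= n)%N) (hk' : (k <= n + m)%N) :
  leading_principal_minor hk (ulsubmx A) = leading_principal_minor hk' A.
Proof.
by congr (\det _); apply/matrixP => i j; rewrite !mxE; congr (A _ _); apply: val_inj.
Qed.

Lemma leading_principal_minor_full (F : fieldType) (n : nat) (A : 'M[F]_n)
    (hn : (n <= n)%N) : leading_principal_minor hn A = \det A.
Proof.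
by congr (\det _); apply/matrixP => i j; rewrite !mxE; congr (A _ _); apply: val_inj.
Qed.

(** The matrix factors as the lower triangular block matrix of [L], [0],
    [v^T], [1] times the upper triangular one of [L^T], [v], [0],
    [d - v^T *m v]. *)
Lemma det_bordered (F : fieldType) (n m : nat) (L : 'M[F]_n)
    (v : 'M[F]_(n, m)) (d : 'M[F]_m) :
  \det (block_mx (L *m L^T) (L *m v) (L *m v)^T d) =
    \det L ^+ 2 * \det (d - v^T *m v).
Proof.
have -> : block_mx (L *m L^T) (L *m v) (L *m v)^T d =
    block_mx L 0 v^T 1%:M *m block_mx L^T v 0 (d - v^T *m v).
  rewrite mulmx_block !mul0mx !mulmx0 !mul1mx !addr0 trmx_mul.
  by rewrite addrC subrK.
by rewrite det_mulmx det_lblock det_ublock det1 mulr1 det_tr mulrA.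
Qed.

(** Inductive step: the new diagonal entry is a positive square root of the
    Schur complement, which is positive because [\det A] is. *)
Lemma has_cholesky_bordered (F : fieldType) (n : nat) (A : 'M[F]_(n + 1)) :
    definite_field F -> A^T = A -> has_cholesky (ulsubmx A) ->
  positive (\det A) -> has_cholesky A.
Proof.
move=> hF symA [L [trigL posL defB]] posA.
have uL := trig_positive_unitmx trigL posL.
pose v := invmx L *m ursubmx A; set d := drsubmx A.
have defA : A = block_mx (L *m L^T) (L *m v) (L *m v)^T d.
  by rewrite mulKVmx // -defB trmx_ursub symA submxK.
have [mu [posmu def_mu]] : exists mu, positive_sqrt (\det (d - v^T *m v)) mu.
  apply: hF; apply: (positive_divX2 posA (y := \det L)).
    by rewrite -unitfE -unitmxE.
  by rewrite {1}defA det_bordered.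
exists (block_mx L 0 v^T mu%:M); split.
- by rewrite is_trig_block_mx // eqxx trigL scalar_mx_is_trig.
- move=> i; case: (split_ordP i) => j ->.
    by rewrite block_mxEul.
  by rewrite block_mxEdr mxE eqxx.
rewrite tr_block_mx mulmx_block !trmx0 !mul0mx !mulmx0 !addr0 trmxK tr_scalar_mx.
rewrite -scalar_mxM -expr2 -def_mu {1}defA trmx_mul; congr block_mx.
by rewrite det_mx11 -mx11_scalar addrC subrK.
Qed.

Theorem corollary1 (F : fieldType) (hF : definite_field F) (n : nat)
    (A : 'M[F]_n) (hA : A^T = A)
    (hminors : forall (k : nat) (hk : (k <= n)%N), (1 <= k)%N ->
       positive (leading_principal_minor hk A)) :
  has_cholesky A.
Proof.
elim: n A hA hminors => [|n IHn] => [A _ _|].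
  exists 0; split; first exact: mx0_is_trig.
    by case.
  by apply/matrixP; case.
(* The block operations split a matrix of size [n + 1] into a leading block of
   size [n], whereas [n.+1] unfolds to [1 + n]. *)
rewrite -(addn1 n) => A symA posA.
apply: has_cholesky_bordered => //; last first.
  by rewrite -(leading_principal_minor_full A (leqnn _)); apply: posA; rewrite addn1.
apply: IHn => [|k hk k_gt0]; first by rewrite trmx_ulsub symA.
rewrite (leading_principal_minor_ulsubmx A hk (leq_trans hk (leq_addr 1 n))).
exact: posA.
Qed.
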